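(* Let $(\mathcal{F}_t)$ be a filtration. Let $\varepsilon_t = \sigma_t z_t$ with $\sigma_t = \exp(H_t)$, $H_t = \bar{H}_t + h_t$, where $\bar{H}_t = E\{H_t\mid\mathcal{F}_{t-1}\}$ is $\mathcal{F}_{t-1}$-measurable, $(h_t)$ is i.i.d. with Laplace density $\frac{1}{2\Delta}\exp(-|x|/\Delta)$, $\Delta = E|h_t|>0$, and $(z_t)$ is i.i.d. $\mathcal{N}(0,1)$, with $z_t$, $h_t$ mutually independent and independent of $\mathcal{F}_{t-1}$. For $\Lambda > 0$ put $\widetilde{\Lambda}_t = \Lambda/(\sqrt{2}e^{\bar{H}_t})$. Then, as $\widetilde{\Lambda}_t \to \infty$, $$P\{|\varepsilon_t| \ge \Lambda \mid \mathcal{F}_{t-1}\} = \frac{1}{2\sqrt{\pi}}\,\Gamma\!\left(\frac{1+1/\Delta}{2}\right)\widetilde{\Lambda}_t^{-1/\Delta} + O\!\left(\widetilde{\Lambda}_t^{-5}e^{-\widetilde{\Lambda}_t^2}\right).$$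
   Context: $\Gamma(\cdot)$ denotes the gamma function. *)

(* Defs.v *)
From HB Require Import structures.
From mathcomp Require Import all_boot all_order all_algebra.
From mathcomp Require Import all_classical all_reals all_analysis.
Set Implicit Arguments. Unset Strict Implicit. Unset Printing Implicit Defensive.
Import Order.TTheory GRing.Theory Num.Theory.
Import numFieldNormedType.Exports.
Local Open Scope classical_set_scope.
Local Open Scope ring_scope.

Section defs.
Context {R : realType} {d : measure_display} {T : measurableType d}.

Definition sub_sigma (G : set (set T)) : Prop :=
  sigma_algebra setT G /\ G `<=` measurable.

Definition G_measurable (G : set (set T)) (f : T -> R) : Prop :=
  forall B : set R, measurable B -> G (f @^-1` B).

Definition filtration (F : nat -> set (set T)) : Prop :=
  (forall n, sub_sigma (F n)) /\ (forall n, F n `<=` F n.+1).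

Definition indep_sigma_rv_rv (P : probability T R) (G : set (set T))
    (X Y : T -> R) : Prop :=
  forall (A : set T) (B C : set R), G A -> measurable B -> measurable C ->
    P (A `&` X @^-1` B `&` Y @^-1` C) = (P A * P (X @^-1` B) * P (Y @^-1` C))%E.

Definition mutually_indep_seq (P : probability T R) (X : nat -> T -> R) : Prop :=
  forall (n : nat) (B : nat -> set R), (forall i, measurable (B i)) ->
    P (\bigcap_(i in `I_n) X i @^-1` B i) = (\prod_(i < n) P (X i @^-1` B i))%E.

Definition has_density (P : probability T R) (X : T -> R) (f : R -> R) : Prop :=
  forall B : set R, measurable B ->
    P (X @^-1` B) = (\int[lebesgue_measure]_(x in B) (f x)%:E)%E.

Definition std_normal (P : probability T R) (X : T -> R) : Prop :=
  forall B : set R, measurable B -> P (X @^-1` B) = normal_prob 0 1 B.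

Definition is_cond_prob (P : probability T R) (G : set (set T)) (A : set T)
    (Y : T -> R) : Prop :=
  [/\ G_measurable G Y, P.-integrable setT (EFin \o Y) &
      forall B, G B -> (\int[P]_(x in B) (Y x)%:E)%E = P (A `&` B)].

End defs.

Definition laplace_pdf {R : realType} (Delta x : R) : R :=
  (2 * Delta)^-1 * expR (- `|x| / Delta).

Definition Gamma {R : realType} (s : R) : R :=
  Rintegral lebesgue_measure `]0, +oo[%classic
    (fun x : R => powR x (s - 1) * expR (- x)).

(* Main.v *)
(** Conditionally on the past, [h] and [z] keep their laws, so the conditional
    probability is the explicit function of [Hbar] obtained by integrating the
    Laplace tail against the Gaussian density.  With [k = 1 / Delta] and
    [w = |z| / (sqrt 2 * L)], the event is [e^h * w >= 1], of Laplace
    probability [w^k / 2] when [w <= 1] and [1 - w^(-k) / 2] when [w > 1].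
    The Gaussian average of [w^k / 2] over the whole line is exactly the Gamma
    term, so the error is minus the average of [cosh (k * ln w) - 1] over
    [w > 1].  This function vanishes to second order at [w = 1] while
    [e^(-z^2/2) = e^(-L^2 w^2)] decays like [e^(-L^2 - 2 L^2 (w - 1))], whence
    the order [L^-5 * e^(-L^2)]. *)

Require Import Defs.
From HB Require Import structures.
From mathcomp Require Import all_boot all_order all_algebra.
From mathcomp Require Import all_classical all_reals all_analysis.
From mathcomp Require Import measurable_realfun ring lra.
Import Order.TTheory GRing.Theory Num.Theory.
Import numFieldNormedType.Exports.
Local Open Scope classical_set_scope.
Local Open Scope ring_scope.

(** * The law of a random variable on an event, as a finite measure *)

Section law_on_event.
Context {R : realType} {d d' : measure_display} {T : measurableType d}
  {T' : measurableType d'}.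
Variables (P : probability T R) (A : set T) (X : T -> T').
Hypotheses (mA : measurable A) (mX : measurable_fun setT X).

(* The two proof arguments are not used in the body: they are what makes
   [law_on] a finite measure, so that its instances can be inferred. *)
Definition law_on of measurable A & measurable_fun setT X : set T' -> \bar R :=
  fun B => P (A `&` X @^-1` B).

Local Notation law := (law_on mA mX).

Let lawE : law = pushforward (mrestr P mA) X.
Proof. by apply/funext => B; rewrite /law_on /pushforward /mrestr setIC. Qed.

Let law0 : law set0 = 0%E.
Proof. by rewrite /law_on preimage_set0 setI0 measure0. Qed.

Let law_ge0 B : (0 <= law B)%E.
Proof. by rewrite lawE; exact: measure_ge0. Qed.

Let law_sigma_additive : semi_sigma_additive law.
Proof. by rewrite lawE; exact: measure_semi_sigma_additive. Qed.

HB.instance Definition _ := isMeasure.Build _ _ _ law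
  law0 law_ge0 law_sigma_additive.

Let law_finite : fin_num_fun law.
Proof.
move=> B mB; apply: fin_num_measure; apply: measurableI => //.
by rewrite -[X in measurable X]setTI; exact: mX.
Qed.

HB.instance Definition _ := Measure_isFinite.Build _ _ _ law law_finite.

(** The law is the pushforward of [P] restricted to [A], and that restriction is zero off [A] and
    equals [P] on subsets of [A]. Splitting the line of integration along [A] and its complement
    gives the change of variables. *)
Lemma ge0_integral_law_on (f : T' -> \bar R) :
  measurable_fun setT f -> (forall y, 0 <= f y)%E ->
  (\int[law]_y f y = \int[P]_(w in A) f (X w))%E.
Proof.
move=> mf f0; rewrite [law in LHS]lawE ge0_integral_pushforward//= preimage_setT.
have mfX : measurable_fun setT (f \o X) by exact: measurableT_comp.
rewrite -(setUv A) ge0_integral_setU//=; last 3 first.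
- exact: measurableC.
- by rewrite setUv.
- exact/disj_setPCl.
rewrite [X in (_ + X)%E](eq_measure_integral mzero); last first.
  move=> B mB BA /=; rewrite /mrestr /mzero (_ : B `&` A = set0) ?measure0//.
  by apply/disjoints_subset.
rewrite integral_measure_zero adde0; apply: eq_measure_integral => B mB BA /=.
by rewrite /mrestr setIidl.
Qed.

End law_on_event.
Arguments law_on {R d d' T T'} P {A X} mA mX.

(** * Comparison of functions measurable for a sub-sigma-algebra *)

Section conditioning.
Context {R : realType} {d : measure_display} {T : measurableType d}.
Variables (P : probability T R) (G : set (set T)).
Hypothesis sG : sub_sigma G.

Lemma G_measurable_fun (f : T -> R) :
  G_measurable G f -> measurable_fun setT f.
Proof. by move=> mf _ B mB; rewrite setTI; apply: sG.2; exact: mf. Qed.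

Let GE : <<s G >> = G.
Proof. exact: sigma_algebra_id sG.1. Qed.

Lemma G_setI (A B : set T) : G A -> G B -> G (A `&` B).
Proof.
by rewrite -{1 2 3}GE; exact: (@measurableI _ (g_sigma_algebraType G)).
Qed.

(** Since [G] generates itself, [G_measurable] is ordinary measurability on [g_sigma_algebraType G],
    where comparison of measurable functions is measurable. *)
Lemma G_measurable_lt (f g : T -> R) : G_measurable G f -> G_measurable G g ->
  G [set w | f w < g w].
Proof.
move=> mf mg.
have mG (u : T -> R) : G_measurable G u ->
    measurable_fun setT (u : g_sigma_algebraType G -> R).
  move=> mu _ B mB; rewrite setTI.
  have : G (u @^-1` B) by exact: mu.
  by rewrite -{1}GE.
have := measurable_fun_ltr (mG _ mf) (mG _ mg).
move=> /(_ measurableT [set true] I); rewrite setTI => h.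
rewrite -GE.
by rewrite (_ : [set w | f w < g w] = (fun x => f x < g x) @^-1` [set true]).
Qed.

(** The set where [g < f] lies in [G], so [f - g] integrates to zero there although it is positive,
    and the set must be null. Applied in both directions, this is the almost sure uniqueness of
    conditional probabilities. *)
Lemma ae_le_of_integral_eq (f g : T -> R) :
  G_measurable G f -> G_measurable G g ->
  P.-integrable setT (EFin \o f) -> P.-integrable setT (EFin \o g) ->
  (forall B, G B -> (\int[P]_(x in B) (f x)%:E = \int[P]_(x in B) (g x)%:E)%E) ->
  {ae P, forall w, f w <= g w}.
Proof.
move=> mf mg fi gi fg.
pose A := [set w | g w < f w].
have GA : G A by exact: G_measurable_lt.
have mA : measurable A by exact: sG.2.
have fiA : P.-integrable A (EFin \o f) by exact: integrableS fi.
have giA : P.-integrable A (EFin \o g) by exact: integrableS gi.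
have fgA : P.-integrable A ((EFin \o f) \- (EFin \o g))%E by exact: integrableB.
have fg0 : (\int[P]_(x in A) ((EFin \o f) x - (EFin \o g) x) = 0)%E.
  rewrite integralB// [X in (X - _)%E](fg _ GA) subee//.
  exact: integrable_fin_num giA.
have : (\int[P]_(x in A) `|((EFin \o f) \- (EFin \o g)) x| = 0)%E.
  rewrite -[RHS]fg0; apply: eq_integral => x; rewrite inE /A/= => gf.
  by rewrite ger0_norm// subr_ge0 ltW.
move/(ae_eq_integral_abs P mA (measurable_int _ fgA)).
apply: filterS => w /= wA; rewrite leNgt; apply/negP => gf.
move: (wA gf) => /eqP; rewrite -EFinB eqe subr_eq0 => /eqP fgw.
by move: gf; rewrite fgw ltxx.
Qed.

End conditioning.

(** * Disintegration: freezing the past while [h] and [z] keep their laws *)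

Section independence.
Context {R : realType} {d : measure_display} {T : measurableType d}.
Variables (P : probability T R) (G : set (set T)).
Hypothesis sG : sub_sigma G.
Variables (h z : T -> R) (mh : measurable_fun setT h) (mz : measurable_fun setT z).
Hypothesis indep : indep_sigma_rv_rv P G h z.
Variables (nu zeta : probability R R).
Hypothesis hnu : forall B, measurable B -> P (h @^-1` B) = nu B.
Hypothesis zzeta : forall B, measurable B -> P (z @^-1` B) = zeta B.

(** Both sides are measures in [D] that agree on rectangles by independence, hence everywhere by
    uniqueness of product measures. The factor [P A] is absorbed as a scaling of [nu]. *)
Lemma indep_joint (A : set T) (D : set (R * R)) : G A -> measurable D ->
  P (A `&` (fun w => (h w, z w)) @^-1` D) = (P A * (nu \x zeta) D)%E.
Proof.
move=> GA mD.
have mA : measurable A by exact: sG.2.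
have mhz : measurable_fun setT (fun w => (h w, z w)) by exact: measurable_fun_pair.
have PA : P A = (fine (P A))%:E by rewrite fineK// fin_num_measure.
have r0 : 0 <= fine (P A) by exact: fine_ge0.
pose m' : {measure set (R * R) -> \bar R} := law_on P mA mhz.
pose m1 : {sigma_finite_measure set R -> \bar R} := mscale (NngNum r0) nu.
have -> : P (A `&` (fun w => (h w, z w)) @^-1` D) = m' D.
  by rewrite /m' /= /law_on.
rewrite -(@product_measure_unique _ _ _ _ _ m1 zeta m' _ D mD).
  rewrite /product_measure1 ge0_integral_mscale//= -?PA//.
  exact: measurable_fun_xsection.
move=> B C mB mC; rewrite /m' /m1 /= /law_on /mscale /= -PA.
rewrite -hnu// -zzeta// -indep//; congr (P _).
by rewrite setIA.
Qed.

Variable X : T -> R.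
Hypothesis GX : G_measurable G X.
Variable S : set (R * (R * R)).
Hypothesis mS : measurable S.

Lemma indep_disintegration (A : set T) : G A ->
  (P (A `&` [set w | S (X w, (h w, z w))]) =
   \int[P]_(w in A) (nu \x zeta) (xsection S (X w)))%E.
Proof.
move=> GA.
have mA : measurable A by exact: sG.2.
have mX : measurable_fun setT X by exact: G_measurable_fun GX.
have mhz : measurable_fun setT (fun w => (h w, z w)) by exact: measurable_fun_pair.
have mXhz : measurable_fun setT (fun w => (X w, (h w, z w))).
  exact: measurable_fun_pair.
pose m' : {measure set (R * (R * R)) -> \bar R} := law_on P mA mXhz.
pose m1 : {finite_measure set R -> \bar R} := law_on P mA mX.
pose m2 := product_subprobability (nu : subprobability R R, zeta : subprobability R R).
transitivity (m' S); first by rewrite /m' /= /law_on.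
rewrite -(@product_measure_unique _ _ _ _ _ m1 m2 m' _ S mS).
  rewrite /product_measure1 ge0_integral_law_on//=.
  exact: (measurable_fun_xsection m2).
move=> B C mB mC; rewrite /m' /m1 /= /law_on -indep_joint//.
  by congr (P _); rewrite setIA.
by apply: G_setI => //; exact: GX.
Qed.

(** The function [q] of [X] is [G]-measurable, bounded by 1, and has the integrals required over
    every set of [G], so it is a version of the conditional probability; any other version [Y]
    agrees with it almost surely. *)
Lemma cond_prob_disintegration (Y : T -> R) :
  is_cond_prob P G [set w | S (X w, (h w, z w))] Y ->
  {ae P, forall w, (Y w)%:E = (nu \x zeta)%E (xsection S (X w))}.
Proof.
move=> [GY iY YE].
pose m2 := product_subprobability (nu : subprobability R R, zeta : subprobability R R).
pose q x := fine ((nu \x zeta)%E (xsection S x)).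
have nz_le1 x : ((nu \x zeta)%E (xsection S x) <= 1)%E.
  apply: le_trans (@sprobability_setT _ _ _ m2).
  by apply: le_measure; rewrite ?inE//; exact: measurable_xsection.
have nz_fin x : (nu \x zeta)%E (xsection S x) \is a fin_num.
  by rewrite ge0_fin_numE// (le_lt_trans (nz_le1 x))// ltry.
have qE x : (q x)%:E = (nu \x zeta)%E (xsection S x) by rewrite /q fineK.
have mq : measurable_fun setT q.
  apply: measurableT_comp => //.
  exact: (measurable_fun_xsection m2).
have Gq : G_measurable G (q \o X).
  move=> B mB; rewrite comp_preimage; apply: GX.
  by rewrite -[X in measurable X]setTI; exact: mq.
have iq : P.-integrable setT (EFin \o (q \o X)).
  have i1 : P.-integrable setT (EFin \o cst 1).
    exact: finite_measure_integrable_cst.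
  apply: (le_integrable _ _ _ i1) => //.
    by apply/measurable_EFinP; exact: G_measurable_fun Gq.
  move=> w _; rewrite [(EFin \o (q \o X)) w]qE [leRHS]/= normr1.
  by rewrite gee0_abs ?nz_le1.
have int_eq B : G B ->
    (\int[P]_(w in B) (Y w)%:E = \int[P]_(w in B) ((q \o X) w)%:E)%E.
  move=> GB; rewrite YE// setIC indep_disintegration//.
  by apply: eq_integral => w _; rewrite [RHS]qE.
have le1 := ae_le_of_integral_eq _ _ sG _ _ GY Gq iY iq int_eq.
have le2 := ae_le_of_integral_eq _ _ sG _ _ Gq GY iq iY (fun B GB => esym (int_eq B GB)).
apply: filterS2 le1 le2 => w h1 h2; rewrite -qE; congr (_%:E).
by apply/eqP; rewrite eq_le h1 h2.
Qed.

End independence.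

(** * Tails of the Laplace law *)

Section laplace.
Context {R : realType}.
Notation mu := (@lebesgue_measure R).
Implicit Types a c : R.

Lemma continuous_expRN c : continuous (fun x : R => expR (- (c * x))).
Proof.
move=> x; apply: continuous_comp; last exact: continuous_expR.
by apply: cvgN; apply: cvgM; [exact: cvg_cst|exact: cvg_id].
Qed.

Lemma integral_expR_tail a c : 0 < c ->
  (\int[mu]_(x in `[a, +oo[) (expR (- (c * x)))%:E = (expR (- (c * a)) / c)%:E)%E.
Proof.
move=> c0.
pose F x := - (expR (- (c * x)) / c).
have dF (x : R) : is_derive x (1 : R) F (expR (- (c * x))).
  apply: trigger_derive; rewrite /GRing.scale/=; field; lra.
rewrite (@ge0_continuous_FTC2y _ _ F a 0).
- by rewrite /F sub0e EFinN oppeK.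
- by move=> x _; exact: expR_ge0.
- by apply: continuous_subspaceT; exact: continuous_expRN.
- rewrite /F -oppr0 -[in X in _ --> - X](mul0r c^-1).
  apply: cvgN; apply: cvgM; last exact: cvg_cst.
  rewrite (_ : (fun x => _) = (fun z => expR (- z)) \o (fun z => c * z))//.
  apply: (@cvg_comp _ _ _ _ _ _ (pinfty_nbhs R)); last exact: cvgr_expR.
  exact: gt0_cvgMry.
- by move=> x _; have [] := dF x.
- apply: cvg_at_right_filter; rewrite /F.
  by apply: cvgN; apply: cvgM; [exact: continuous_expRN|exact: cvg_cst].
- by move=> x _; rewrite derive1E; have [] := dF x.
Qed.

Lemma continuous_laplace_pdf c : continuous (laplace_pdf c).
Proof.
move=> x; apply: cvgM; first exact: cvg_cst.
apply: continuous_comp; last exact: continuous_expR.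
apply: cvgM; last exact: cvg_cst.
by apply: cvgN; exact: norm_continuous.
Qed.

Lemma laplace_pdf_ge0 c x : 0 < c -> 0 <= laplace_pdf c x.
Proof.
by move=> c0; rewrite mulr_ge0 ?expR_ge0// invr_ge0 mulr_ge0// ltW.
Qed.

Lemma measurable_laplace_pdf c : measurable_fun setT (laplace_pdf c).
Proof. exact: continuous_measurable_fun (@continuous_laplace_pdf c). Qed.

Lemma integral_laplace_pdf_tail a c : 0 < c -> 0 <= a ->
  (\int[mu]_(x in `[a, +oo[) (laplace_pdf c x)%:E =
   (expR (- (c^-1 * a)) / 2)%:E)%E.
Proof.
move=> c0 a0.
transitivity (\int[mu]_(x in `[a, +oo[)
    ((expR (- (c^-1 * x)))%:E * ((2 * c)^-1)%:E))%E.
  apply: eq_integral => x; rewrite inE/= in_itv/= andbT => ax.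
  rewrite /laplace_pdf ger0_norm ?(le_trans a0)// mulNr -EFinM.
  by congr (_%:E); rewrite mulrC (mulrC x).
rewrite ge0_integralZr//=; last 2 first.
- apply/measurable_EFinP; apply: measurable_funTS.
  by apply: continuous_measurable_fun; exact: continuous_expRN.
- by rewrite lee_fin invr_ge0 mulr_ge0// ltW.
rewrite integral_expR_tail ?invr_gt0// -EFinM; congr (_%:E).
by field; lra.
Qed.

Variables (nu : probability R R) (Delta : R).
Hypothesis Delta0 : 0 < Delta.
Hypothesis nuE : forall B, measurable B ->
  nu B = (\int[mu]_(x in B) (laplace_pdf Delta x)%:E)%E.

Lemma laplace_tail_ge0 a : 0 <= a ->
  nu `[a, +oo[%classic = (expR (- (Delta^-1 * a)) / 2)%:E.
Proof. by move=> a0; rewrite nuE// integral_laplace_pdf_tail. Qed.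

(** Passing to the complement and reflecting the even density reduces a threshold [a <= 0] to the
    tail above [- a]. *)
Lemma laplace_tail_le0 a : a <= 0 ->
  nu `[a, +oo[%classic = (1 - expR (Delta^-1 * a) / 2)%:E.
Proof.
move=> a0; rewrite -setCitvl probability_setC// EFinB; congr (1 - _)%E.
rewrite nuE// -[a]opprK integral_itv_bndo_bndc; last first.
  by apply/measurable_EFinP; apply: measurable_funTS; exact: measurable_laplace_pdf.
rewrite ge0_integration_by_substitutionNy; last 2 first.
- by apply: continuous_subspaceT; exact: continuous_laplace_pdf.
- by move=> x _; exact: laplace_pdf_ge0.
under eq_integral do rewrite /= /laplace_pdf normrN.
by rewrite integral_laplace_pdf_tail ?oppr_ge0// !mulrN.
Qed.

(* [cosh (k * ln w) - 1] for [w > 1]. *)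
Definition tail_gap (k w : R) : R :=
  if 1 < w then (w `^ k + w `^ (- k)) / 2 - 1 else 0.

(** Taking logarithms turns the event into a tail above [- ln w], whose probability has two formulas
    according to the sign of [ln w]. Adding [tail_gap] merges them into a single power of [w], which
    can then be integrated over the whole line. *)
Lemma laplace_exp_tail (w : R) : 0 <= w ->
  (nu [set u | (1 <= expR u * w)%R] + (tail_gap Delta^-1 w)%:E =
   (w `^ Delta^-1 / 2)%:E)%E.
Proof.
rewrite le_eqVlt => /predU1P[<-|w0].
  (* At [w = 0] the event is empty, and the power vanishes because its exponent is nonzero. *)
  rewrite (_ : [set u | _] = set0) ?measure0; last first.
    by rewrite -subset0 => u /=; rewrite mulr0 ler10.
  by rewrite /tail_gap ltr10 powR0 ?mul0r ?adde0// gt_eqF// invr_gt0.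
rewrite (_ : [set u | _] = `[- ln w, +oo[%classic); last first.
  have tailE u : (1 <= expR u * w) = (- ln w <= u).
    by rewrite -[w in LHS]lnK// -expRD -[X in X <= _]expR0 ler_expR -lerBlDr sub0r.
  by apply/seteqP; split=> u /=; rewrite in_itv/= andbT tailE.
rewrite /tail_gap /powR (gt_eqF w0); case: ltP => w1.
  rewrite laplace_tail_le0 ?oppr_le0 ?ln_ge0 ?ltW// -EFinD; congr (_%:E).
  by rewrite mulrN mulNr; lra.
rewrite laplace_tail_ge0 ?oppr_ge0 ?ln_le0// adde0; congr (_%:E).
by rewrite mulrN opprK.
Qed.

End laplace.

(** * Pointwise bounds on the gap *)

Section gap_bound.
Context {R : realType}.
Implicit Types k w L : R.

(** The left side equals [(1 - expR (- a)) ^+ 2 * expR a / 2], and [1 - expR (- a)] lies between 0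
    and [a]. *)
Lemma coshB1_le (a : R) : 0 <= a ->
  (expR a + expR (- a)) / 2 - 1 <= a ^+ 2 * expR a / 2.
Proof.
move=> a0.
have ea := expR_gt0 a; have e1 := expRxMexpNx_1 a.
have h : 0 <= 1 - expR (- a) <= a.
  have := expR_ge1Dx (- a).
  by have : expR (- a) <= 1; [rewrite -expR0 ler_expR oppr_le0|lra].
have -> : (expR a + expR (- a)) / 2 - 1 = (1 - expR (- a)) ^+ 2 * expR a / 2.
  by apply: (@mulfI _ 2%:R); [lra|]; rewrite !mulr_natl; nra.
apply: ler_wpM2r => //; apply: ler_wpM2r; first exact: ltW.
by apply: lerXn2r; rewrite ?nnegrE; lra.
Qed.

(** With [v = w ^ k] the gap is [(v - 1) ^+ 2 / (2 * v)]. *)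
Lemma tail_gap_ge0 k w : 0 <= tail_gap k w.
Proof.
rewrite /tail_gap; case: ifPn => // w1; have w0 : 0 < w by lra.
have wk : 0 < w `^ k by rewrite powR_gt0.
rewrite powRN; have := sqr_ge0 (w `^ k - 1).
set v := w `^ k in wk *; move=> h.
rewrite (_ : (v + v^-1) / 2 - 1 = (v - 1) ^+ 2 / (2 * v)); last by field; lra.
by rewrite divr_ge0// mulr_ge0// ltW.
Qed.

Lemma tail_gap_le1 k w : w <= 1 -> tail_gap k w = 0.
Proof. by rewrite /tail_gap ltNge => ->. Qed.

(** This is [coshB1_le] at [a = k * ln w], followed by [ln w <= w - 1]. *)
Lemma tail_gap_le k w : 0 <= k -> 1 < w ->
  tail_gap k w <= k ^+ 2 * (w - 1) ^+ 2 / 2 * expR (k * (w - 1)).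
Proof.
move=> k0 w1; have w0 : 0 < w by lra.
rewrite /tail_gap w1 /powR gt_eqF// mulNr.
have lnw : 0 <= ln w <= w - 1.
  apply/andP; split; first exact: ln_ge0 (ltW w1).
  by have := expR_ge1Dx (ln w); rewrite lnK ?posrE//; lra.
have a0 : 0 <= k * ln w by apply: mulr_ge0; lra.
have ak : k * ln w <= k * (w - 1) by apply: ler_wpM2l; lra.
apply: le_trans (coshB1_le _ a0) _.
rewrite -exprMn mulrAC; apply: ler_pM.
- by rewrite divr_ge0// exprn_ge0.
- exact: expR_ge0.
- by apply: ler_wpM2r => //; apply: lerXn2r; rewrite ?nnegrE//; lra.
- by rewrite ler_expR.
Qed.

(** Put [s = w - 1], so that [(L * w) ^+ 2 = L ^+ 2 + 2 * L ^+ 2 * s + L ^+ 2 * s ^+ 2]. Of the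
    decay [2 * L ^+ 2 * s], one half pays for replacing [s ^+ 2] by a multiple of [L ^- 4], a
    quarter absorbs the growth [k * s], and the last quarter remains in the bound. *)
Lemma gauss_tail_gap_le k w L : 0 <= k -> 1 + 2 * k <= L -> 0 <= w ->
  expR (- (L * w) ^+ 2) * tail_gap k w <=
  k ^+ 2 * L ^- 4 * expR (- L ^+ 2) * expR (- (L ^+ 2 / 2 * (w - 1))).
Proof.
move=> k0 kL w0.
have L0 : 0 < L by lra.
have [w1|w1] := leP w 1.
  rewrite tail_gap_le1// mulr0; do 2![apply: mulr_ge0; last exact: expR_ge0].
  by rewrite mulr_ge0 ?sqr_ge0// invr_ge0 exprn_ge0// ltW.
have kL2 : k <= L ^+ 2 / 2 by nra.
set s := w - 1; have s0 : 0 < s by rewrite /s; lra.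
have L4 : 0 < L ^+ 4 by exact: exprn_gt0.
have sq : s ^+ 2 <= 2 / L ^+ 4 * expR (L ^+ 2 * s).
  (* Only the constant and quadratic terms of the exponential series at [L ^+ 2 * s] are kept. *)
  have h : 1 + L ^+ 4 * s ^+ 2 / 2 <= expR (L ^+ 2 * s).
    rewrite (_ : L ^+ 4 * s ^+ 2 = (L ^+ 2 * s) ^+ 2); last by ring.
    by apply: (@expR_ge1Dxn _ _ 1); rewrite mulr_ge0 ?sqr_ge0// ltW.
  by rewrite mulrAC ler_pdivlMr//; lra.
apply: (@le_trans _ _ (expR (- (L * w) ^+ 2) *
    (k ^+ 2 * (2 / L ^+ 4 * expR (L ^+ 2 * s)) / 2 * expR (k * s)))).
  apply: ler_wpM2l; first exact: expR_ge0.
  apply: le_trans (tail_gap_le _ _ k0 w1) _.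
  apply: ler_wpM2r; first exact: expR_ge0.
  by apply: ler_wpM2r => //; apply: ler_wpM2l => //; exact: sqr_ge0.
rewrite (_ : _ * _ = k ^+ 2 / L ^+ 4 * (expR (- (L * w) ^+ 2) *
    (expR (L ^+ 2 * s) * expR (k * s)))); last by field; lra.
rewrite -[leRHS]mulrA -!expRD; apply: ler_wpM2l.
  by rewrite divr_ge0 ?sqr_ge0// ltW.
rewrite ler_expR (_ : w = 1 + s); last by rewrite /s; ring.
nra.
Qed.

End gap_bound.

(** * Even integrands and the substitution [y = sqrt (2 * u)] *)

Section line_integrals.
Context {R : realType}.
Notation mu := (@lebesgue_measure R).

Lemma ge0_integral_even (f : R -> \bar R) :
  measurable_fun setT f -> (forall x, 0 <= f x)%E -> (forall x, f (- x) = f x) ->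
  (\int[mu]_x f x = 2%:E * \int[mu]_(x in `[0%R, +oo[) f x)%E.
Proof.
move=> mf f0 fN.
rewrite -(setUv `]-oo, 0%R]%classic) ge0_integral_setU//=; last 3 first.
- exact: measurableC.
- by rewrite setUv.
- exact/disj_setPCl.
rewrite setCitvl integral_itv_obnd_cbnd; last exact: measurable_funTS.
rewrite [X in (X + _)%E](_ : _ = \int[mu]_(x in `[0%R, +oo[) f x)%E.
  by rewrite -[2]/(1 + 1 : R) EFinD ge0_muleDl// mul1e.
rewrite ge0_integration_by_substitution0//.
by apply: eq_integral => x _; rewrite fN.
Qed.

Lemma bigcup_itvcy (a : R^nat) : (forall n, 0 < a n) -> a n @[n --> \oo] --> 0 ->
  \bigcup_n `[a n, +oo[%classic = `]0, +oo[%classic.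
Proof.
move=> a0 acv; apply/seteqP; split=> x /=.
  by move=> [n _] /=; rewrite !in_itv/= !andbT; exact: lt_le_trans.
rewrite in_itv/= andbT => x0.
have /cvgr0Pnorm_le /(_ x x0) [n _ /(_ n (leqnn n))] := acv.
by rewrite gtr0_norm// => an; exists n => //=; rewrite in_itv/= an.
Qed.

(* The substitution [y = sqrt (2 * u)], i.e. [u = y ^ 2 / 2] and [dy = du / y]. *)
Definition sqrt2M (u : R) : R := Num.sqrt 2 * Num.sqrt u.

Lemma sqrt2M_gt0 u : 0 < u -> 0 < sqrt2M u.
Proof. by move=> u0; rewrite mulr_gt0// sqrtr_gt0. Qed.

Lemma continuous_sqrt2M : continuous sqrt2M.
Proof. by move=> u; apply: cvgM; [exact: cvg_cst|exact: sqrt_continuous]. Qed.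

Lemma is_derive_sqrt2M (u : R) : 0 < u -> is_derive u (1 : R) sqrt2M (sqrt2M u)^-1.
Proof.
move=> u0; have du := is_derive1_sqrt u0.
apply: trigger_derive; rewrite /GRing.scale/= /sqrt2M.
have s2 : Num.sqrt 2 != 0 :> R by rewrite gt_eqF// sqrtr_gt0.
have su : Num.sqrt u != 0 by rewrite gt_eqF// sqrtr_gt0.
have : Num.sqrt 2 ^+ 2 = 2 :> R by rewrite sqr_sqrtr.
rewrite expr2; move: (Num.sqrt 2) s2 => s s2 e2.
by rewrite -e2; field; rewrite s2 su.
Qed.

Lemma sqrt2M_cvgy : sqrt2M u @[u --> +oo] --> +oo.
Proof.
apply/cvgryPge => A; near=> u.
have u1 : 1 <= Num.sqrt 2 :> R by rewrite -[leLHS]sqrtr1 ler_sqrt ?ler1n.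
have uA : A <= Num.sqrt u.
  apply: le_trans (ler_norm A) _; rewrite -sqrtr_sqr ler_sqrt.
    by near: u; apply: nbhs_pinfty_ge; rewrite num_real.
  by near: u; apply: nbhs_pinfty_ge; rewrite num_real.
by apply: le_trans uA _; rewrite /sqrt2M ler_peMl// sqrtr_ge0.
Unshelve. all: by end_near. Qed.

(** Starting at [a > 0] keeps the derivative of [sqrt2M] convergent at the left endpoint, as the
    substitution rule demands; at infinity it tends to 0. *)
Lemma integral_sqrt2M_cy (G : R -> R) a : 0 < a ->
  {in `]0, +oo[, continuous G} -> (forall x, 0 <= G x) ->
  (\int[mu]_(y in `[sqrt2M a, +oo[) (G y)%:E =
   \int[mu]_(u in `[a, +oo[) (G (sqrt2M u) / sqrt2M u)%:E)%E.
Proof.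
move=> a0 cG G0.
have dF u : 0 < u -> derive1 sqrt2M u = (sqrt2M u)^-1.
  by move=> u0; rewrite derive1E; have [] := is_derive_sqrt2M u u0.
have cF' u : 0 < u -> {for u, continuous (derive1 sqrt2M)}.
  move=> u0; have h : (sqrt2M x)^-1 @[x --> u] --> derive1 sqrt2M u.
    rewrite dF//; apply: cvgV; first by rewrite gt_eqF// sqrt2M_gt0.
    exact: continuous_sqrt2M.
  apply: cvg_trans h; apply: near_eq_cvg.
  by near=> x; rewrite dF//; near: x; exact: lt_nbhsr.
have Fa0 := sqrt2M_gt0 a a0.
rewrite increasing_ge0_integration_by_substitutiony.
- apply: eq_integral => u; rewrite inE/= in_itv/= andbT => au.
  by rewrite fctE /= dF// (lt_le_trans a0).
- move=> x y; rewrite !in_itv/= !andbT => ax ay xy.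
  rewrite /sqrt2M ltr_pM2l ?sqrtr_gt0// ltr_sqrt//.
  by rewrite (lt_trans _ xy)// (lt_le_trans a0).
- move=> x; rewrite in_itv/= andbT => ax; apply: cF'; exact: lt_trans ax.
- apply/cvg_ex; exists (derive1 sqrt2M a); apply: cvg_at_right_filter.
  exact: cF'.
- apply/cvg_ex; exists 0.
  have h : (sqrt2M x)^-1 @[x --> +oo] --> (0 : R).
    apply/gtr0_cvgV0; last exact: sqrt2M_cvgy.
    by near=> x; apply: sqrt2M_gt0; near: x; exact: nbhs_pinfty_gt.
  apply: cvg_trans h; apply: near_eq_cvg.
  by near=> x; rewrite dF//; near: x; exact: nbhs_pinfty_gt.
- split.
    move=> x; rewrite in_itv/= andbT => ax.
    by have [] := is_derive_sqrt2M x (lt_trans a0 ax).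
  by apply: cvg_at_right_filter; exact: continuous_sqrt2M.
- exact: sqrt2M_cvgy.
- apply/continuous_within_itvcyP; split.
    move=> x; rewrite in_itv/= andbT => ax; apply: cG.
    by rewrite in_itv/= andbT (lt_trans Fa0).
  by apply: cvg_at_right_filter; apply: cG; rewrite in_itv/= andbT.
- by move=> x _.
Unshelve. all: by end_near. Qed.

(* [G (sqrt2M u) / sqrt2M u] may blow up at [0], hence the passage to the limit
   over [`[n.+1^-1, +oo[]. *)
Lemma integral_sqrt2M (G : R -> R) :
  {in `]0, +oo[, continuous G} -> (forall x, 0 <= G x) ->
  (\int[mu]_(y in `]0%R, +oo[) (G y)%:E =
   \int[mu]_(u in `]0%R, +oo[) (G (sqrt2M u) / sqrt2M u)%:E)%E.
Proof.
move=> cG G0.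
have inv_cvg : (n.+1%:R^-1 : R) @[n --> \oo] --> (0 : R) by exact: cvg_harmonic.
have mpos (f : R -> R) : {in `]0, +oo[, continuous f} -> forall b : R, 0 < b ->
    measurable_fun `[b, +oo[ (EFin \o f).
  move=> cf b b0; apply/measurable_EFinP.
  have mf : measurable_fun `](0:R), +oo[%classic f.
    apply: open_continuous_measurable_fun => // x; rewrite inE => x0.
    exact: cf.
  apply: (measurable_funS _ _ mf) => //.
  by move=> x /=; rewrite !in_itv/= !andbT; exact: lt_le_trans.
(* Monotone convergence along growing half-lines, for a general sequence of endpoints because it
   serves both sides: with endpoints [sqrt2M (a n)] for [y] and [a n] for [u]. *)
have cvgI (f : R -> R) (a : R^nat) : (forall n, 0 < a n) -> nonincreasing_seq a ->
    a n @[n --> \oo] --> 0 -> {in `]0, +oo[, continuous f} ->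
    (forall x, 0 < x -> 0 <= f x) ->
    (\int[mu]_(x in `[a n, +oo[) (f x)%:E @[n --> \oo] -->
     \int[mu]_(x in `]0%R, +oo[) (f x)%:E)%E.
  move=> a0 na acv cf f0; rewrite -(bigcup_itvcy a)//.
  apply: ge0_nondecreasing_set_cvg_integral => //.
  - move=> m n mn; apply/subsetPset => x /=; rewrite !in_itv/= !andbT.
    by apply: le_trans; exact: na.
  - by move=> n; exact: mpos.
  - move=> n x /=; rewrite in_itv/= andbT lee_fin => an.
    by apply: f0; exact: lt_le_trans an.
pose a n : R := n.+1%:R^-1.
have a0 n : 0 < a n by rewrite invr_gt0.
have na : nonincreasing_seq a.
  by move=> m n mn; rewrite lef_pV2 ?posrE// ler_nat.
have F0 : sqrt2M (a n) @[n --> \oo] --> 0.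
  rewrite -[X in _ --> X](_ : sqrt2M 0 = 0); last by rewrite /sqrt2M sqrtr0 mulr0.
  by apply: continuous_cvg => //; exact: continuous_sqrt2M.
have h1 := cvgI G (sqrt2M \o a) (fun n => sqrt2M_gt0 _ (a0 n)).
have h2 := cvgI (fun u => G (sqrt2M u) / sqrt2M u) a a0 na inv_cvg.
apply: (cvg_unique _ (h1 _ F0 cG _)) => //.
  move=> m n mn /=; rewrite /sqrt2M ler_pM2l ?sqrtr_gt0// ler_sqrt//.
    exact: na.
  exact: ltW.
rewrite /mkset (_ : (fun n => _) = (fun n =>
    \int[mu]_(u in `[a n, +oo[) (G (sqrt2M u) / sqrt2M u)%:E)%E); last first.
  by apply/funext => n; rewrite /= integral_sqrt2M_cy.
apply: h2 => //.
  move=> x; rewrite in_itv/= andbT => x0.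
  apply: cvgM.
    apply: continuous_comp; first exact: continuous_sqrt2M.
    by apply: cG; rewrite in_itv/= andbT sqrt2M_gt0.
  apply: cvgV; first by rewrite gt_eqF// sqrt2M_gt0.
  exact: continuous_sqrt2M.
by move=> x x0; rewrite divr_ge0// ltW// sqrt2M_gt0.
Qed.

End line_integrals.

(** * Gaussian averages of the power and of the gap *)

Section gauss_integrals.
Context {R : realType}.
Notation mu := (@lebesgue_measure R).
Variables k L : R.
Hypotheses (k0 : 0 < k) (L0 : 0 < L).

Let w (y : R) : R := `|y| / (Num.sqrt 2 * L).

Let s2 : 0 < Num.sqrt 2 :> R. Proof. by rewrite sqrtr_gt0. Qed.
Let s2L : 0 < Num.sqrt 2 * L. Proof. exact: mulr_gt0. Qed.
Let spi : 0 < Num.sqrt pi :> R. Proof. by rewrite sqrtr_gt0 pi_gt0. Qed.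

Lemma std_normal_pdfE (y : R) : normal_pdf 0 1 y =
  (Num.sqrt 2 * Num.sqrt pi)^-1 * expR (- (y ^+ 2 / 2)).
Proof.
rewrite normal_pdfE ?oner_neq0// /normal_peak /normal_fun subr0 expr1n mul1r.
by rewrite -[pi *+ 2]mulr_natl sqrtrM// -[1 *+ 2]/(2 : R) mulNr.
Qed.

Lemma continuous_powR_gt0 (x : R) : 0 < x -> {for x, continuous (@powR R ^~ k)}.
Proof.
move=> x0; apply: differentiable_continuous; apply/derivable1_diffP.
by apply: derivable_powR; rewrite in_itv/= x0.
Qed.

Let G (y : R) : R := normal_pdf 0 1 y * (w y `^ k / 2).

Let G0 y : 0 <= G y.
Proof. by rewrite /G mulr_ge0 ?normal_pdf_ge0// divr_ge0// powR_ge0. Qed.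

Let mw : measurable_fun setT w.
Proof. by apply: measurable_funM => //; exact: measurableT_comp. Qed.

Let mG : measurable_fun setT G.
Proof.
apply: measurable_funM; first exact: measurable_normal_pdf.
apply: measurable_funM => //.
by apply: (@measurableT_comp _ _ _ _ _ _ (@powR R ^~ k)) => //; exact: measurable_powR.
Qed.

Let cG : {in `]0, +oo[, continuous G}.
Proof.
move=> y; rewrite in_itv/= andbT => y0.
apply: cvgM; first exact: continuous_normal_pdf (oner_neq0 _) _.
apply: cvgM; last exact: cvg_cst.
apply: (@continuous_comp _ _ _ w (@powR R ^~ k)).
  by apply: cvgM; [exact: norm_continuous|exact: cvg_cst].
by apply: continuous_powR_gt0; rewrite /w divr_gt0// normr_gt0 gt_eqF.
Qed.

(** Under the substitution [y ^+ 2 / 2] becomes [u] and [w] becomes [Num.sqrt u / L], which produces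
    the Gamma integrand. The leading 2 comes from evenness, and the two factors [Num.sqrt 2], from
    the Gaussian peak and from the Jacobian, multiply to 2. *)
Let GF u : 0 < u -> 2 * (G (sqrt2M u) / sqrt2M u) =
  (2 * Num.sqrt pi)^-1 * L `^ (- k) * (u `^ ((1 + k) / 2 - 1) * expR (- u)).
Proof.
move=> u0; have su : 0 < Num.sqrt u by rewrite sqrtr_gt0.
have F0 := sqrt2M_gt0 u u0.
have F2 : sqrt2M u ^+ 2 / 2 = u.
  by rewrite exprMn !sqr_sqrtr ?ltW// mulrC mulKf.
have wF : w (sqrt2M u) = Num.sqrt u * L^-1.
  by rewrite /w gtr0_norm// /sqrt2M; field; rewrite !gt_eqF.
have uk : Num.sqrt u `^ k = u `^ (k / 2).
  by rewrite -powR12_sqrt ?ltW// -powRrM mulrC.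
have us : u `^ ((1 + k) / 2 - 1) = u `^ (k / 2) / Num.sqrt u.
  rewrite -powR12_sqrt ?ltW// -powRB; last by rewrite (gt_eqF u0) implybT.
  by congr (_ `^ _); field.
rewrite /G std_normal_pdfE F2 wF powRM ?invr_ge0 ?ltW// uk us.
rewrite -(powR_inv1 (ltW L0)) -powRrM mulN1r.
have : Num.sqrt 2 ^+ 2 = 2 :> R by rewrite sqr_sqrtr.
rewrite /sqrt2M.
move: (Num.sqrt 2) s2 => s s0 e2.
rewrite (_ : (2 * Num.sqrt pi)^-1 = (s ^+ 2 * Num.sqrt pi)^-1); last by rewrite e2.
by field; rewrite !gt_eqF.
Qed.

(** An absolute Gaussian moment of order [k]. The Gamma integral stays in the extended reals, so the
    identity needs no prior proof of convergence. *)
Lemma gauss_power_integral :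
  (\int[mu]_y (normal_pdf 0 1 y * ((`|y| / (Num.sqrt 2 * L)) `^ k / 2))%:E =
   ((2 * Num.sqrt pi)^-1 * L `^ (- k))%:E *
   \int[mu]_(u in `]0%R, +oo[) (u `^ ((1 + k) / 2 - 1) * expR (- u))%:E)%E.
Proof.
rewrite (@ge0_integral_even _ (EFin \o G)); last 3 first.
- exact/measurable_EFinP.
- by move=> y; rewrite /= lee_fin.
- by move=> y; rewrite /= /G /w normrN !std_normal_pdfE sqrrN.
rewrite -integral_itv_obnd_cbnd; last by apply/measurable_EFinP; exact: measurable_funTS.
rewrite integral_sqrt2M//.
have mGF : measurable_fun setT (fun u => G (sqrt2M u) / sqrt2M u).
  have mF : measurable_fun setT (@sqrt2M R).
    by apply: continuous_measurable_fun; exact: continuous_sqrt2M.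
  apply: measurable_funM; first exact: measurableT_comp.
  (* The reciprocal is a power with exponent [-1], since [sqrt2M] is nonnegative on the whole line;
     powers are measurable. *)
  rewrite (_ : (fun u => _) = (@powR R ^~ (-1)) \o (@sqrt2M R)).
    by apply: measurableT_comp => //; exact: measurable_powR.
  by apply/funext => u /=; rewrite powR_inv1// mulr_ge0 ?sqrtr_ge0.
rewrite -ge0_integralZl//=; last 2 first.
- by apply/measurable_EFinP; exact: measurable_funTS.
- move=> u; rewrite in_itv/= andbT => u0; rewrite lee_fin divr_ge0// ltW//.
  exact: sqrt2M_gt0.
rewrite -ge0_integralZl//=; last 3 first.
- apply/measurable_EFinP; apply: measurable_funTS; apply: measurable_funM.
    exact: measurable_powR.
  by apply: measurableT_comp.
- by move=> u _; rewrite lee_fin mulr_ge0// ?powR_ge0 ?expR_ge0.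
- by rewrite lee_fin mulr_ge0 ?powR_ge0// invr_ge0 mulr_ge0 ?sqrtr_ge0.
apply: eq_integral => u; rewrite inE/= in_itv/= andbT => u0.
by rewrite -!EFinM GF.
Qed.

Lemma measurable_tail_gap : measurable_fun setT (fun y => tail_gap k (w y)).
Proof.
apply: measurable_fun_ifT => //.
- by apply: measurable_fun_ltr.
- apply: measurable_funB => //; apply: measurable_funM => //.
  by apply: measurable_funD;
    apply: (@measurableT_comp _ _ _ _ _ _ (@powR R ^~ _)) => //;
    exact: measurable_powR.
Qed.

Let H (y : R) : R := normal_pdf 0 1 y * tail_gap k (w y).

Let H0 y : 0 <= H y.
Proof. by rewrite /H mulr_ge0 ?normal_pdf_ge0// tail_gap_ge0. Qed.

Let mH : measurable_fun setT H.
Proof.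
apply: measurable_funM; first exact: measurable_normal_pdf.
exact: measurable_tail_gap.
Qed.

(** The gap vanishes below [y = Num.sqrt 2 * L], where [w = 1]. Beyond that point
    [gauss_tail_gap_le] gives an exponential majorant in [y] of rate proportional to [L]; its
    integral supplies the fifth factor [L^-1]. *)
Lemma gauss_gap_integral : 1 + 2 * k <= L ->
  (\int[mu]_y (normal_pdf 0 1 y *
     tail_gap k (`|y| / (Num.sqrt 2 * L)))%:E <=
   (4 * k ^+ 2 / Num.sqrt pi * (L ^- 5 * expR (- L ^+ 2)))%:E)%E.
Proof.
move=> kL.
rewrite (@ge0_integral_even _ (EFin \o H)); last 3 first.
- exact/measurable_EFinP.
- by move=> y; rewrite /= lee_fin.
- by move=> y; rewrite /= /H /w normrN !std_normal_pdfE sqrrN.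
pose a := Num.sqrt 2 * L.
have -> : (\int[mu]_(y in `[0%R, +oo[) (EFin \o H) y =
           \int[mu]_(y in `[a, +oo[) (EFin \o H) y)%E.
  rewrite integral_mkcond [RHS]integral_mkcond; apply: eq_integral => y _.
  rewrite !patchE !mem_setE !in_itv/= !andbT.
  have [ay|ya] := leP a y; first by rewrite (le_trans (ltW s2L) ay).
  case: ifPn => // y0; rewrite /= /H tail_gap_le1 ?mulr0//.
  by rewrite /w ger0_norm// ler_pdivrMr// mul1r ltW.
(* As [w y = y / a], the exponent [L ^+ 2 / 2 * (w y - 1)] is [c * y - L ^+ 2 / 2]. The constant
   part goes into [K] and is cancelled at the end by [expR (- (c * a))]. *)
pose c := L ^+ 2 / (2 * a).
pose K := (Num.sqrt 2 * Num.sqrt pi)^-1 * (k ^+ 2 * L ^- 4 * expR (- L ^+ 2)) *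
  expR (L ^+ 2 / 2).
have K0 : 0 <= K.
  apply: mulr_ge0; last exact: expR_ge0.
  apply: mulr_ge0; first by rewrite invr_ge0 mulr_ge0 ?sqrtr_ge0.
  apply: mulr_ge0; last exact: expR_ge0.
  by rewrite mulr_ge0 ?sqr_ge0// invr_ge0 exprn_ge0// ltW.
have c0 : 0 < c by rewrite /c divr_gt0 ?exprn_gt0// mulr_gt0.
apply: (@le_trans _ _ (2%:E * \int[mu]_(y in `[a, +oo[)
    (K%:E * (expR (- (c * y)))%:E)))%E.
  apply: lee_wpmul2l; first by rewrite lee_fin.
  apply: ge0_le_integral => //=.
  - by move=> y _; rewrite lee_fin.
  - by apply/measurable_EFinP; exact: measurable_funTS.
  - apply/measurable_EFinP; apply: measurable_funTS; apply: measurable_funM => //.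
    by apply: continuous_measurable_fun; exact: continuous_expRN.
  move=> y; rewrite in_itv/= andbT => ay.
  have y0 : 0 < y by exact: lt_le_trans ay.
  rewrite -EFinM lee_fin /H std_normal_pdfE -mulrA.
  rewrite /K -[leRHS]mulrA -[leRHS]mulrA; apply: ler_wpM2l.
    by rewrite invr_ge0 mulr_ge0 ?sqrtr_ge0.
  have w0 : 0 <= w y by rewrite /w divr_ge0// ltW.
  have := gauss_tail_gap_le _ _ _ (ltW k0) kL w0.
  have -> : (L * w y) ^+ 2 = y ^+ 2 / 2.
    rewrite /w gtr0_norm//; have : Num.sqrt 2 ^+ 2 = 2 :> R by rewrite sqr_sqrtr.
    move: (Num.sqrt 2) s2 => s s0 e2.
    by rewrite -[in RHS]e2; field; rewrite !gt_eqF.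
  move=> h; apply: le_trans h _; rewrite -expRD.
  rewrite (_ : L ^+ 2 / 2 + - (c * y) = - (L ^+ 2 / 2 * (w y - 1)))//.
  by rewrite /c /w gtr0_norm// /a; field; rewrite !gt_eqF.
rewrite ge0_integralZl//=; last first.
  apply/measurable_EFinP; apply: measurable_funTS.
  by apply: continuous_measurable_fun; exact: continuous_expRN.
rewrite integral_expR_tail// -!EFinM lee_fin.
have ca : c * a = L ^+ 2 / 2 by rewrite /c; field; rewrite !gt_eqF.
rewrite ca /K /c /a (expRN (L ^+ 2 / 2)); have := expR_gt0 (L ^+ 2 / 2).
move: (expR (L ^+ 2 / 2)) => E E0.
rewrite le_eqVlt; apply/orP; left; apply/eqP; field.
by rewrite !gt_eqF.
Qed.

End gauss_integrals.

(** * The exceedance probability for a frozen value of the past *)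

Section exceedance.
Context {R : realType}.
Notation mu := (@lebesgue_measure R).
Variables nu zeta : probability R R.
Hypothesis zetaE : forall B, measurable B -> zeta B = normal_prob 0 1 B.

(** Tonelli puts the integral over the first coordinate inside, so that the exact Laplace tail can
    be used at each fixed [y]. *)
Lemma product_std_normalE (D : set (R * R)) : measurable D ->
  ((nu \x zeta) D =
   \int[mu]_y ((normal_pdf 0 1 y)%:E * nu (ysection D y)))%E.
Proof.
move=> mD.
pose f (p : R * R) : \bar R := (normal_pdf 0 1 p.2 * \1_D p)%:E.
have f0 p : (0 <= f p)%E by rewrite lee_fin mulr_ge0// normal_pdf_ge0.
have mf : measurable_fun setT f.
  apply/measurable_EFinP; apply: measurable_funM; last exact: measurable_indic.
  by apply: measurableT_comp => //; exact: measurable_normal_pdf.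
transitivity (\int[nu]_u \int[mu]_y f (u, y))%E.
  apply: eq_integral => u _ /=.
  rewrite zetaE; last exact: measurable_xsection.
  rewrite /normal_prob integral_mkcond; apply: eq_integral => y _.
  rewrite patchE /f /= indicE mem_xsection.
  by case: (_ \in _); rewrite ?mulr1 ?mulr0.
transitivity (\int[mu]_y \int[nu]_u f (u, y))%E.
  exact: (@fubini_tonelli _ _ _ _ _ nu mu f mf f0).
apply: eq_integral => y _.
rewrite /f /=; under eq_integral do rewrite EFinM.
rewrite ge0_integralZl_EFin//=; last 2 first.
- apply/measurable_EFinP.
  have -> : (fun u => \1_D (u, y)) = \1_(ysection D y) :> (R -> R).
    by apply/funext => u; rewrite !indicE mem_ysection.
  by apply: measurable_indic; exact: measurable_ysection.
- exact: normal_pdf_ge0.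
congr (_ * _)%E.
under eq_integral => u _.
  rewrite (_ : \1_D (u, y) = \1_(ysection D y) u); last first.
    by rewrite !indicE mem_ysection.
  over.
by rewrite integral_indic ?setIT//; exact: measurable_ysection.
Qed.

(** The coordinates are grouped as past, then the pair of innovations, so that the section at a
    value of the past is an event for [nu \x zeta]. *)
Definition exceedance (Lambda : R) : set (R * (R * R)) :=
  [set p | Lambda <= `|expR (p.1 + p.2.1) * p.2.2|].

Lemma measurable_exceedance Lambda : measurable (exceedance Lambda).
Proof.
have mf : measurable_fun setT
    (fun p : R * (R * R) => `|expR (p.1 + p.2.1) * p.2.2|).
  apply: measurableT_comp => //; apply: measurable_funM.
    apply: measurableT_comp => //; apply: measurable_funD => //.
    exact: measurableT_comp.
  exact: measurableT_comp.
rewrite (_ : exceedance Lambda =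
  (fun p : R * (R * R) => `|expR (p.1 + p.2.1) * p.2.2|) @^-1` `[Lambda, +oo[%classic).
  by rewrite -[X in measurable X]setTI; exact: mf.
by apply/seteqP; split=> p /=; rewrite in_itv/= andbT.
Qed.

Variable Delta : R.
Hypothesis Delta0 : 0 < Delta.
Hypothesis nuE : forall B, measurable B ->
  nu B = (\int[mu]_(x in B) (laplace_pdf Delta x)%:E)%E.

(** Integrating [laplace_exp_tail] against the Gaussian density shows that the probability plus the
    averaged gap is exactly the Gamma term. The error is therefore minus that average, which
    [gauss_gap_integral] bounds. *)
Lemma exceedance_asymptotics (Lambda x : R) : 0 < Lambda ->
  let L := Lambda / (Num.sqrt 2 * expR x) in
  1 + 2 * Delta^-1 <= L ->
  `|fine ((nu \x zeta)%E (xsection (exceedance Lambda) x)) -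
    (2 * Num.sqrt pi)^-1 * Gamma ((1 + Delta^-1) / 2) * L `^ (- Delta^-1)| <=
  4 * Delta^-1 ^+ 2 / Num.sqrt pi * (L ^- 5 * expR (- L ^+ 2)).
Proof.
move=> Lam0 L hL.
have k0 : 0 < Delta^-1 by rewrite invr_gt0.
have s2 : 0 < Num.sqrt 2 :> R by rewrite sqrtr_gt0.
have spi : 0 < Num.sqrt pi :> R by rewrite sqrtr_gt0 pi_gt0.
have ex := expR_gt0 x.
have L0 : 0 < L by rewrite /L divr_gt0// mulr_gt0.
have mS := measurable_exceedance Lambda.
have mSx : measurable (xsection (exceedance Lambda) x) by exact: measurable_xsection.
set p := (nu \x zeta)%E _.
pose E := (\int[mu]_y (normal_pdf 0 1 y *
  tail_gap Delta^-1 (`|y| / (Num.sqrt 2 * L)))%:E)%E.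
(* [Lambda] and [x] enter only through [L], and at fixed [y] the event has the form treated by
   [laplace_exp_tail]. *)
have sectionE y : ysection (xsection (exceedance Lambda) x) y =
    [set u | 1 <= expR u * (`|y| / (Num.sqrt 2 * L))].
  have thresholdE u : (Lambda <= `|expR (x + u) * y|) =
      (1 <= expR u * (`|y| / (Num.sqrt 2 * L))).
    rewrite normrM ger0_norm ?expR_ge0// expRD.
    rewrite (_ : expR u * _ = expR x * expR u * `|y| / Lambda).
      by rewrite ler_pdivlMr// mul1r.
    by rewrite /L; field; rewrite !gt_eqF.
  by apply/seteqP; split=> u;
    rewrite /ysection /= inE /xsection /= inE /exceedance /= thresholdE.
have wk0 y : 0 <= (`|y| / (Num.sqrt 2 * L)) by rewrite divr_ge0// mulr_ge0// ltW.
have pE : (p + E = \int[mu]_y (normal_pdf 0 1 y *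
    ((`|y| / (Num.sqrt 2 * L)) `^ Delta^-1 / 2))%:E)%E.
  rewrite /p product_std_normalE// /E -ge0_integralD//=; first last.
  - apply/measurable_EFinP; apply: measurable_funM; first exact: measurable_normal_pdf.
    exact: measurable_tail_gap.
  - by move=> y _; rewrite lee_fin mulr_ge0 ?normal_pdf_ge0 ?tail_gap_ge0.
  - apply: emeasurable_funM; last exact: measurable_fun_ysection.
    by apply/measurable_EFinP; exact: measurable_normal_pdf.
  - by move=> y _; rewrite mule_ge0// lee_fin normal_pdf_ge0.
  apply: eq_integral => y _; rewrite EFinM -ge0_muleDr ?lee_fin ?tail_gap_ge0//.
  by rewrite sectionE (laplace_exp_tail _ _ Delta0 nuE) ?EFinM.
have p1 : (p <= 1)%E.
  pose m2 := product_subprobability (nu : subprobability R R,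
    zeta : subprobability R R).
  apply: le_trans (@sprobability_setT _ _ _ m2).
  by apply: le_measure; rewrite ?inE.
have p0 : (0 <= p)%E by exact: measure_ge0.
have p_fin : p \is a fin_num by rewrite ge0_fin_numE// (le_lt_trans p1)// ltry.
have E_le := gauss_gap_integral _ _ k0 L0 hL.
rewrite -/E in E_le.
have E0 : (0 <= E)%E.
  by apply: integral_ge0 => y _; rewrite lee_fin mulr_ge0 ?normal_pdf_ge0 ?tail_gap_ge0.
have E_fin : E \is a fin_num by rewrite ge0_fin_numE// (le_lt_trans E_le)// ltry.
move: pE; rewrite gauss_power_integral//.
set c := (2 * Num.sqrt pi)^-1 * L `^ (- Delta^-1).
have c0 : 0 < c by rewrite mulr_gt0 ?powR_gt0// invr_gt0 mulr_gt0.
set I := (\int[_]_(_ in _) _)%E => pE.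
have I0 : (0 <= I)%E.
  by apply: integral_ge0 => u _; rewrite lee_fin mulr_ge0 ?powR_ge0 ?expR_ge0.
(* Convergence of the Gamma integral comes for free: a positive multiple of it equals [p + E], and
   both terms are finite. *)
have I_fin : I \is a fin_num.
  have : (p + E)%E \is a fin_num by rewrite fin_numD p_fin E_fin.
  rewrite pE => cI; rewrite ge0_fin_numE//.
  rewrite ltNge leye_eq; apply/negP => /eqP IE.
  by move: cI; rewrite IE gt0_muley ?lte_fin.
have -> : Gamma ((1 + Delta^-1) / 2) = fine I by [].
have : fine p + fine E = c * fine I.
  by rewrite -fineD// pE fineM.
rewrite mulrAC -/c => <-; rewrite opprD addrA subrr add0r normrN.
rewrite ger0_norm ?fine_ge0//.
by rewrite -lee_fin fineK.
Qed.

End exceedance.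

Theorem theorem2p3 (R : realType) (d : measure_display) (T : measurableType d)
  (P : probability T R) (F : nat -> set (set T))
  (Hbar h z : nat -> T -> R) (Delta : R) :
  filtration F ->
  0 < Delta ->
  (forall t, G_measurable (F t) (Hbar t.+1)) ->
  (forall t, measurable_fun setT (h t)) ->
  (forall t, measurable_fun setT (z t)) ->
  (forall t, has_density P (h t) (laplace_pdf Delta)) ->
  (forall t, std_normal P (z t)) ->
  mutually_indep_seq P h ->
  mutually_indep_seq P z ->
  (forall t, indep_sigma_rv_rv P (F t) (h t.+1) (z t.+1)) ->
  forall t : nat,
  let eps := fun w => expR (Hbar t.+1 w + h t.+1 w) * z t.+1 w in
  exists C M : R, 0 < M /\
    forall Lambda : R, 0 < Lambda ->
    let Lt := fun w => Lambda / (Num.sqrt 2 * expR (Hbar t.+1 w)) in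
    forall Y : T -> R,
      is_cond_prob P (F t) [set w | Lambda <= `|eps w|] Y ->
      {ae P, forall w, M <= Lt w ->
        `|Y w - (2 * Num.sqrt pi)^-1 * Gamma ((1 + Delta^-1) / 2)
                  * powR (Lt w) (- Delta^-1)|
        <= C * (Lt w ^- 5 * expR (- Lt w ^+ 2))}.
Proof.
move=> [sF _] D0 GH mh mz dh nz _ _ ind t eps.
(* Bundling [h] and [z] at time [t.+1] as measurable functions makes their distributions probability
   measures. *)
pose hm_ := isMeasurableFun.Build _ _ _ _ _ (mh t.+1).
pose hm : {mfun T >-> R} := HB.pack (h t.+1) hm_.
pose zm_ := isMeasurableFun.Build _ _ _ _ _ (mz t.+1).
pose zm : {mfun T >-> R} := HB.pack (z t.+1) zm_.
pose nu : probability R R := distribution P hm.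
pose zeta : probability R R := distribution P zm.
have k0 : 0 < Delta^-1 by rewrite invr_gt0.
(* Both constants depend on [Delta] alone. The threshold [1 + 2 * Delta^-1] ensures
   [Delta^-1 <= L ^+ 2 / 2], so that the Gaussian decay beats the growth of the gap. *)
exists (4 * Delta^-1 ^+ 2 / Num.sqrt pi), (1 + 2 * Delta^-1); split; first lra.
move=> Lambda Lam0 Lt Y cY.
have mS := @measurable_exceedance R Lambda.
have nuE B : measurable B -> P (h t.+1 @^-1` B) = nu B by [].
have zetaE B : measurable B -> P (z t.+1 @^-1` B) = zeta B by [].
have YE := cond_prob_disintegration _ _ (sF t) _ _ (mh t.+1) (mz t.+1) (ind t)
  nu zeta nuE zetaE _ (GH t) _ mS Y cY.
apply: filterS YE => w Yw wM.
have -> : Y w = fine ((nu \x zeta)%E (xsection (exceedance Lambda) (Hbar t.+1 w))).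
  by rewrite -Yw.
exact: (exceedance_asymptotics nu zeta (nz t.+1) _ D0 (dh t.+1) _ _ Lam0 wM).
Qed.
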